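(* Let $\mathcal{H}_1,\mathcal{H}_2$ be real Hilbert spaces and let $A:\mathcal{H}_1\to\mathcal{H}_2$ be a bounded linear operator with $\|A\|>0$ and adjoint $A^*$. If $T:\mathcal{H}_2\to\mathcal{H}_2$ is firmly nonexpansive, then the operator $V:\mathcal{H}_1\to\mathcal{H}_1$ defined by $$V:=\mathrm{Id}+\frac{1}{\|A\|^2}A^*(T-\mathrm{Id})A,\qquad\text{i.e. } Vx=x+\frac{1}{\|A\|^2}A^*(T(Ax)-Ax),$$ is firmly nonexpansive.
   Context: $\mathrm{Id}$ denotes the identity operator. An operator $S:\mathcal{H}\to\mathcal{H}$ (not necessarily linear) on a real Hilbert space $\mathcal{H}$ is firmly nonexpansive if $\langle Sx-Sy,x-y\rangle\ge\|Sx-Sy\|^2$ for all $x,y\in\mathcal{H}$. The operator $V$ is called the Landweber-type operator related to $T$. *)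

(* Defs.v *)
From HB Require Import structures.
From mathcomp Require Import all_boot all_order all_algebra.
From mathcomp Require Import all_classical all_reals all_analysis.
From mathcomp Require Import ring lra.
Import Order.TTheory GRing.Theory Num.Theory numFieldNormedType.Exports.

Set Implicit Arguments.
Unset Strict Implicit.
Unset Printing Implicit Defensive.

Local Open Scope classical_set_scope.
Local Open Scope ring_scope.

(* Completeness comes from the underlying completeNormedModType; the mixin
   only adds that the norm is induced by a real inner product. *)
HB.mixin Record CompleteNormedModule_isHilbert (R : realType) H
    & CompleteNormedModule R H := {
  inner : {dot H for (@idfun R)} ;
  inner_normE : forall x : H, inner x x = `|x| ^+ 2
}.

#[short(type="hilbertType")]
HB.structure Definition Hilbert (R : realType) :=
  {H of CompleteNormedModule_isHilbert R H & CompleteNormedModule R H}.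

Arguments inner {R H} : rename.

Notation "''[' x , y ]" := (inner x y) : ring_scope.

Definition firmly_nonexpansive (R : realType) (H : hilbertType R)
    (S : H -> H) : Prop :=
  forall x y, `|S x - S y| ^+ 2 <= '[S x - S y, x - y].

(* Meaningful when A is bounded: the supremum of an unbounded set is 0. *)
Definition opnorm (R : realType) (H1 H2 : hilbertType R)
    (A : {linear H1 -> H2}) : R :=
  sup [set `|A x| | x in [set x : H1 | `|x| <= 1]].

(* When A is bounded, A^* y is the unique z such that <A x, y> = <x, z> for
   all x, by the Riesz representation theorem: see adjointP and adjoint_uniq. *)
Definition adjoint (R : realType) (H1 H2 : hilbertType R)
    (A : {linear H1 -> H2}) (y : H2) : H1 :=
  xget 0 [set z | forall x, '[A x, y] = '[x, z]].

Definition landweber (R : realType) (H1 H2 : hilbertType R)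
    (A : {linear H1 -> H2}) (T : H2 -> H2) (x : H1) : H1 :=
  x + (opnorm A ^+ 2)^-1 *: adjoint A (T (A x) - A x).

Section HilbertTheory.
Context {R : realType} {H : hilbertType R}.
Implicit Types x y z : H.

Lemma innerC x y : '[x, y] = '[y, x].
Proof. by rewrite hermC expr0 mul1r. Qed.

Lemma innerDl x y z : '[x + y, z] = '[x, z] + '[y, z].
Proof. exact: linearDl. Qed.

Lemma innerDr x y z : '[x, y + z] = '[x, y] + '[x, z].
Proof. exact: linearDr. Qed.

Lemma innerBl x y z : '[x - y, z] = '[x, z] - '[y, z].
Proof. exact: linearBl. Qed.

Lemma innerBr x y z : '[x, y - z] = '[x, y] - '[x, z].
Proof. exact: linearBr. Qed.

Lemma innerZl a x y : '[a *: x, y] = a * '[x, y].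
Proof. by rewrite linearZl_LR. Qed.

Lemma innerZr a x y : '[x, a *: y] = a * '[x, y].
Proof. by rewrite innerC innerZl innerC. Qed.

Lemma inner_le x y : '[x, y] <= `|x| * `|y|.
Proof.
have := inner_normE (x + y); rewrite innerDl !innerDr !inner_normE (innerC y x).
have : `|x + y| ^+ 2 <= (`|x| + `|y|) ^+ 2.
  by rewrite lerXn2r ?nnegrE ?addr_ge0// ler_normD.
move: (`|x + y|) '[x, y] => s i; rewrite !expr2; nra.
Qed.

Lemma inner_norm_le x y : `|'[x, y]| <= `|x| * `|y|.
Proof.
rewrite ler_norml inner_le andbT lerNl.
have := inner_le (- x) y; rewrite normrN; apply: le_trans.
by rewrite -(scaleN1r x) innerZl mulN1r.
Qed.

Lemma riesz (f : H -> R) (C : R) :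
  (forall a u v, f (a *: u + v) = a * f u + f v) ->
  (forall x, `|f x| <= C * `|x|) ->
  exists z, forall x, f x = '[x, z].
Proof.
move=> fP fC.
have fZ a u : f (a *: u) = a * f u.
  have f0 : f 0 = 0 by have := fP 1 0 0; rewrite scaler0 addr0; lra.
  by have := fP a u 0; rewrite f0 !addr0.
pose J x := '[x, x] / 2 - f x.
pose m := inf (range J).
have hJ : has_inf (range J).
  split; first by exists (J 0), 0.
  exists (- (C ^+ 2 / 2)) => _ [x _ <-].
  have := fC x; rewrite ler_norml => /andP[_ h].
  rewrite /J inner_normE.
  have := sqr_ge0 (`|x| - C); rewrite !expr2; nra.
have Jm x : m <= J x by apply: ge_inf; [exact: hJ.2|exists x].
have /choice[u uP] : forall n : nat, exists x, J x < m + n.+1%:R^-1.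
  move=> n; have n0 : 0 < n.+1%:R^-1 :> R by rewrite invr_gt0.
  by have [_ [x _ <-] ?] := inf_adherent n0 hJ; exists x.
have inv_mono N n : (N <= n)%N -> n.+1%:R^-1 <= N.+1%:R^-1 :> R.
  by move=> Nn; rewrite lef_pV2 ?posrE// ler_nat ltnS.
have arch (e : R) : 0 < e -> exists N : nat, N.+1%:R^-1 < e.
  move=> e0; have [N _ hN] := @near_infty_natSinv_lt R (PosNum e0).
  by exists N; have := hN N (leqnn N).
have para n k : `|u n - u k| ^+ 2 <= 4 * (n.+1%:R^-1 + k.+1%:R^-1).
  have := uP n; have := uP k; have := Jm (2^-1 *: u n + 2^-1 *: u k).
  rewrite /J fP fZ -inner_normE.
  rewrite !(innerBl, innerBr, innerDl, innerDr, innerZl, innerZr).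
  rewrite (innerC (u k) (u n)).
  by move: (n.+1%:R^-1) (k.+1%:R^-1) => a b; lra.
have ucv : cvgn u.
  apply: cauchy_cvg; apply: cauchy_exP => e e0.
  have e8 : 0 < e ^+ 2 / 8 by rewrite divr_gt0 ?exprn_gt0.
  have [N hN] := arch _ e8.
  exists (u N); exists N => // n /= Nn.
  rewrite -ball_normE /=.
  rewrite -(@ltr_pXn2r _ 2)// ?nnegrE ?(ltW e0)//.
  apply: le_lt_trans (para N n) _.
  move: hN (inv_mono _ _ Nn).
  by move: (N.+1%:R^-1) (n.+1%:R^-1) => a b; lra.
set z := limn u; exists z => x.
apply/eqP; rewrite eq_sym -subr_eq0; apply/eqP; rewrite innerC.
set d := '[z, x] - f x.
have quad t : 0 <= t ^+ 2 * (`|x| ^+ 2 / 2) + t * d.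
  apply/ler_addgt0Pr => e e0; rewrite -[X in _ <= X]addrC -lerBlDl sub0r.
  have tx0 : 0 < e / 2 / (`|t| * `|x| + 1).
    by rewrite !divr_gt0// ltr_wpDl ?mulr_ge0.
  have e20 : 0 < e / 2 by rewrite divr_gt0.
  have /cvgrPdist_lt /(_ _ tx0) [N1 _ hN1] := ucv.
  have [N2 hN2] := arch _ e20.
  pose n := maxn N1 N2.
  have h1 := hN1 n (leq_maxl _ _).
  have h2 := le_lt_trans (inv_mono _ _ (leq_maxr N1 N2)) hN2.
  have h3 : t * ('[u n, x] - '[z, x]) <= e / 2.
    rewrite -innerBl (le_trans (ler_norm _))// normrM.
    apply: le_trans (_ : `|t| * (`|z - u n| * `|x|) <= _).
      by rewrite ler_wpM2l// (distrC z) inner_norm_le.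
    move: h1; rewrite /= ltr_pdivlMr ?ltr_wpDl ?mulr_ge0//.
    have := normr_ge0 (z - u n); move: (`|z - u n|) => w; lra.
  have := uP n; have := Jm (t *: x + u n).
  rewrite /J fP !(innerDl, innerDr, innerZl, innerZr) (innerC x).
  rewrite (inner_normE x) /d expr2; move: h2 h3; rewrite -/n.
  by move: (n.+1%:R^-1) => a; lra.
have q0 : 0 < `|x| ^+ 2 + 1 by rewrite ltr_wpDl ?sqr_ge0.
have := quad (- d / (`|x| ^+ 2 + 1)); move: q0 (sqr_ge0 `|x|).
move: (`|x| ^+ 2) => q q0 qge0.
have -> : (- d / (q + 1)) ^+ 2 * (q / 2) + - d / (q + 1) * d =
          - (d ^+ 2 * ((q / 2 + 1) / (q + 1) ^+ 2)).
  by field; rewrite gt_eqF.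
rewrite oppr_ge0 pmulr_lle0 ?divr_gt0 ?exprn_gt0//; last lra.
by move=> d0; apply/eqP; rewrite -sqrf_eq0 eq_le d0 sqr_ge0.
Qed.

End HilbertTheory.

Section Adjoint.
Context {R : realType} {H1 H2 : hilbertType R} (A : {linear H1 -> H2}).

Lemma adjointP : bounded_fun_norm A ->
  forall x y, '[A x, y] = '[x, adjoint A y].
Proof.
move=> bA x y; rewrite /adjoint; case: xgetP => [z _ -> //|noz].
have [C hC] := bA 1.
have AC v : `|A v| <= C * `|v|.
  have [->|v0] := eqVneq v 0; first by rewrite linear0 !normr0 mulr0.
  have nv : 0 < `|v| by rewrite normr_gt0.
  have := hC (`|v|^-1 *: v); rewrite linearZ/= !normrZ gtr0_norm ?invr_gt0//.
  by rewrite mulVf ?gt_eqF// => /(_ (lexx _)); rewrite mulrC ler_pdivrMr.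
have [|v|z zP] := @riesz R H1 (fun v => '[A v, y]) (C * `|y|).
- by move=> a u v; rewrite linearP innerDl innerZl.
- by apply: le_trans (inner_norm_le _ _) _; rewrite mulrAC ler_wpM2r.
by case: (noz z).
Qed.

Lemma adjoint_uniq : bounded_fun_norm A -> forall y z,
  (forall x, '[A x, y] = '[x, z]) -> z = adjoint A y.
Proof.
move=> bA y z zP; apply/eqP; rewrite -subr_eq0 -normr_eq0 -sqrf_eq0.
by rewrite -inner_normE innerBr -zP -(adjointP bA) subrr.
Qed.

End Adjoint.

(* Main.v *)
(* Firm nonexpansiveness of [landweber A T] amounts to
   [<d, q> + |q|^2 / |A|^2 <= 0], where [d = x - y], [p] is the increment of
   [T - Id] between [A x] and [A y], and [q = A^* p].  Now [<d, q> = <A d, p>]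
   and [|q| <= |A| |p|], while firm nonexpansiveness of [T] says exactly that
   [<A d, p> + |p|^2 <= 0]. *)
Require Import Defs.
From mathcomp Require Import all_boot all_order all_algebra.
From mathcomp Require Import all_classical all_reals all_analysis.
From mathcomp Require Import lra.
Import Order.TTheory GRing.Theory Num.Theory numFieldNormedType.Exports.

Local Open Scope classical_set_scope.
Local Open Scope ring_scope.

(** Boundedness on the unit ball makes the set under [sup] bounded above, so [sup] is a genuine
    upper bound. *)
Lemma opnorm_ub (R : realType) (H1 H2 : hilbertType R)
    (A : {linear H1 -> H2}) (x : H1) :
  bounded_fun_norm A -> `|x| <= 1 -> `|A x| <= opnorm A.
Proof.
move=> bA x1; have [C hC] := bA 1.
apply: ub_le_sup; first by exists C => _ [v /= v1 <-]; exact: hC.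
by exists x.
Qed.

Lemma opnorm_ge0 (R : realType) (H1 H2 : hilbertType R)
    (A : {linear H1 -> H2}) :
  bounded_fun_norm A -> 0 <= opnorm A.
Proof.
by move=> bA; apply: le_trans (@opnorm_ub _ _ _ A 0 bA _); rewrite ?normr0.
Qed.

Lemma opnorm_le (R : realType) (H1 H2 : hilbertType R)
    (A : {linear H1 -> H2}) (x : H1) :
  bounded_fun_norm A -> `|A x| <= opnorm A * `|x|.
Proof.
move=> bA; have [->|x0] := eqVneq x 0; first by rewrite linear0 !normr0 mulr0.
have nx : 0 < `|x| by rewrite normr_gt0.
have := @opnorm_ub _ _ _ A (`|x|^-1 *: x) bA.
rewrite linearZ/= !normrZ gtr0_norm ?invr_gt0// mulVf ?gt_eqF//.
by move=> /(_ (lexx _)); rewrite mulrC ler_pdivrMr.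
Qed.

(** [adjoint] is a choice made pointwise, so additivity has to come from uniqueness. *)
Lemma adjointB (R : realType) (H1 H2 : hilbertType R)
    (A : {linear H1 -> H2}) (y z : H2) :
  bounded_fun_norm A -> adjoint A (y - z) = adjoint A y - adjoint A z.
Proof.
move=> bA; apply/esym/adjoint_uniq => // x.
by rewrite !innerBr !adjointP.
Qed.

Lemma adjoint_norm_le (R : realType) (H1 H2 : hilbertType R)
    (A : {linear H1 -> H2}) (y : H2) :
  bounded_fun_norm A -> `|adjoint A y| <= opnorm A * `|y|.
Proof.
move=> bA; set q := adjoint A y.
have [->|q0] := eqVneq q 0; first by rewrite normr0 mulr_ge0 ?opnorm_ge0.
have nq : 0 < `|q| by rewrite normr_gt0.
(* After multiplying by [|q|], the left side is ['[q, q] = '[A q, y]], ready for Cauchy-Schwarz. *)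
rewrite -(ler_pM2r nq) -expr2 -inner_normE -(adjointP bA).
apply: le_trans (inner_le _ _) _.
by rewrite mulrAC ler_wpM2r// opnorm_le.
Qed.

Theorem proposition4 (R : realType) (H1 H2 : hilbertType R)
    (A : {linear H1 -> H2}) (T : H2 -> H2) :
  bounded_fun_norm A -> 0 < opnorm A ->
  firmly_nonexpansive T -> firmly_nonexpansive (landweber A T).
Proof.
move=> bA L0 fT x y.
set d := x - y; set p := (T (A x) - A x) - (T (A y) - A y).
set c := (opnorm A ^+ 2)^-1; set q := adjoint A p.
have c0 : 0 < c by rewrite invr_gt0 exprn_gt0.
have -> : landweber A T x - landweber A T y = d + c *: q.
  by rewrite /landweber opprD addrACA -scalerBr -adjointB.
(* With [u = A d] and [w = T (A x) - T (A y)], [p = w - u], so the left side is ['[w, p] = |w|^2 -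
   '[w, u]]. *)
have Tp : '[A d, p] + `|p| ^+ 2 <= 0.
  have := fT (A x) (A y); rewrite -linearB -/d.
  have -> : p = (T (A x) - T (A y)) - A d.
    by rewrite /p /d (linearB A) !opprD addrACA.
  move: (T (A x) - T (A y)) (A d) => w u.
  by rewrite -!inner_normE !(innerBl, innerBr) (innerC u w); lra.
have qp : c * `|q| ^+ 2 <= `|p| ^+ 2.
  rewrite mulrC ler_pdivrMr ?exprn_gt0// mulrC -exprMn.
  by rewrite lerXn2r ?nnegrE ?mulr_ge0 ?(ltW L0)// adjoint_norm_le.
(* This product is exactly [|d + c q|^2 - '[d + c q, d]]. *)
have : c * ('[d, q] + c * `|q| ^+ 2) <= 0.
  by rewrite pmulr_rle0// -(adjointP bA); lra.
rewrite -!inner_normE; move: (d) (q) => u v.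
by rewrite !(innerDl, innerDr, innerZl, innerZr) (innerC v u); lra.
Qed.
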